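(* Let $q>9$ be an odd prime power of characteristic $p$, $A=\mathbb{F}_q[T]$. Let $\mathcal{W}^3=\{(g_1,g_2,g_3)\in A^3: g_3\neq0\}$ and let $\mathcal{S}^3\subseteq\mathcal{W}^3$ be the set of $\vec g=(g_1,g_2,g_3)$ such that $\nu_{(T)}(g_i)=0$ for $i=1,2,3$, and there exists a nonzero prime ideal $\mathfrak{l}\neq(T)$ of $A$ with $\nu_{\mathfrak{l}}(g_2)=0$ and $p\nmid\nu_{\mathfrak{l}}(g_3)$. Then the density of $\mathcal{S}^3$ exists and equals $\left(1-\frac1q\right)^3$.
   Context: $\nu_{\mathfrak{l}}$ is the normalized $\mathfrak{l}$-adic valuation. For $g\in A$ let $|g|=q^{\deg_T g}$ if $g\neq0$ and $|0|=0$; for $\vec g\in A^r$ let $|\vec g|=\max_i|g_i|$. For $N>0$ let $\mathcal{W}^r(N)=\{\vec g\in\mathcal{W}^r:|\vec g|<q^N\}$ and for $\mathcal{S}\subseteq\mathcal{W}^r$ let $\mathcal{S}(N)=\mathcal{S}\cap\mathcal{W}^r(N)$. The density of $\mathcal{S}$ is $\lim_{N\to\infty}|\mathcal{S}(N)|/|\mathcal{W}^r(N)|$ when the limit exists. *)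

(* Defs.v *)
From HB Require Import structures.
From mathcomp Require Import all_boot all_order all_algebra.
From mathcomp Require Import ring_quotient finmap.
From mathcomp Require Import all_classical all_reals all_analysis.
Set Implicit Arguments.
Unset Strict Implicit.
Unset Printing Implicit Defensive.
Import Order.TTheory GRing.Theory Num.Theory.
Import numFieldNormedType.Exports.
Local Open Scope classical_set_scope.
Local Open Scope ring_scope.

Section Ideals.
Variable A : comNzRingType.
Implicit Types I J : set A.

Definition principal_ideal (f : A) : set A := [set x | exists h, x = h * f].

(* [idealr_closed] includes properness ([1 \notin I]). *)
Definition nonzero_prime_ideal I : Prop :=
  [/\ idealr_closed (mem I), prime_idealr_closed (mem I) & I <> [set 0]].

Definition ideal_mul I J : set A :=
  [set x | exists s : seq (A * A),
     (forall ab, ab \in s -> I ab.1 /\ J ab.2) /\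
     x = \sum_(ab <- s) ab.1 * ab.2].

Definition ideal_pow I (n : nat) : set A := iter n (ideal_mul I) setT.

(* The I-adic valuation: the n with x in I^n but not in I^(n+1). Such an n is
   unique when it exists, as the powers of I are nested; [None] stands for
   +oo, the value at x = 0. *)
Definition adic_val I (x : A) : option nat :=
  xget None [set v | exists2 n, v = Some n &
                       ideal_pow I n x /\ ~ ideal_pow I n.+1 x].

End Ideals.

Section Density.
Variable F : finFieldType.
Local Notation A := {poly F}.

Definition absA (g : A) : nat :=
  if g == 0 then 0%N else (#|F| ^ (size g).-1)%N.

Definition abs3 (g : A * A * A) : nat :=
  let: (g1, g2, g3) := g in maxn (maxn (absA g1) (absA g2)) (absA g3).

Definition W3 : set (A * A * A) := [set g | g.2 != 0].

Definition trunc3 (S : set (A * A * A)) (N : nat) : set (A * A * A) :=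
  S `&` [set g | W3 g /\ (abs3 g < #|F| ^ N)%N].

(* [fset_set] is faithful here: only finitely many g have |g| < q^N. *)
Definition density_ratio (R : realType) (S : set (A * A * A)) (N : nat) : R :=
  #|` fset_set (trunc3 S N)|%:R / #|` fset_set (trunc3 W3 N)|%:R.

Definition has_density (R : realType) (S : set (A * A * A)) (d : R) : Prop :=
  density_ratio R S N @[N --> \oo] --> d.

Definition S3 (p : nat) : set (A * A * A) :=
  [set g | let: (g1, g2, g3) := g in
     let nuT := adic_val (principal_ideal 'X) in
     [/\ W3 g,
         [/\ nuT g1 = Some 0%N, nuT g2 = Some 0%N & nuT g3 = Some 0%N] &
         exists l : set A,
           [/\ nonzero_prime_ideal l,
               l <> principal_ideal 'X,
               adic_val l g2 = Some 0%N &
               exists2 n, adic_val l g3 = Some n & ~~ (p %| n)%N]]].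

End Density.

(* Main.v *)
Require Import Defs.
From mathcomp Require Import all_boot all_order all_algebra.
From mathcomp Require Import ring_quotient finmap zify ring lra.
From mathcomp Require Import all_classical all_reals all_analysis.
Set Implicit Arguments.
Unset Strict Implicit.
Unset Printing Implicit Defensive.
Import Order.TTheory GRing.Theory Num.Theory.
Import numFieldNormedType.Exports.
Local Open Scope classical_set_scope.
Local Open Scope ring_scope.

(** The triples of polynomials with nonzero constant terms have density
    (1 - 1/q)^3, so it suffices that those of them outside S^3 are negligible.
    For such a triple every prime dividing g_3 exactly once divides g_2; hence
    g_3 = s a^2 b^3 with s dividing g_2, say g_2 = s m.  If g_2 and g_3 have
    degree < N then deg s + deg m < N and deg a + deg b < N / 2, so there are
    only O(N^3 q^(3N/2)) such pairs (g_2, g_3) among about q^(2N). *)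

(** * Squarefull decomposition of polynomials over a field *)

Section PolyFactorization.
Variable F : fieldType.
Implicit Types f g l : {poly F}.

Lemma irreducible_factor f : (1 < size f)%N ->
  exists2 l, irreducible_poly l & l %| f.
Proof.
have [n] := ubnP (size f); elim: n f => // n IHn f; rewrite ltnS => lefn f_gt1.
have [irr_f | nirr] := pselect (irreducible_poly f); first by exists f.
have f_neq0 : f != 0 by rewrite -size_poly_gt0 (ltn_trans _ f_gt1).
have [d [d1 df ndf]] :
    exists d : {poly F}, [/\ size d != 1%N, d %| f & ~~ (d %= f)].
  apply: contrapT => no; apply: nirr; split=> // d d1 df.
  by apply: contrapT => /negP ndf; apply: no; exists d.
have d_neq0 : d != 0 by apply: contraNneq f_neq0 => d0; rewrite d0 dvd0p in df.
have ltdf : (size d < size f)%N.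
  by rewrite ltn_neqAle dvdp_leq // andbT (dvdp_size_eqp df).
have [||l irr_l ld] := IHn d.
- exact: leq_trans ltdf _.
- by rewrite ltn_neqAle eq_sym d1 size_poly_gt0.
by exists l => //; apply: dvdp_trans ld df.
Qed.

Lemma irreducible_dvdpM l f g :
  irreducible_poly l -> (l %| f * g) = (l %| f) || (l %| g).
Proof.
move=> irr_l; apply/idP/orP => [lfg|[]]; last 2 first.
- exact: dvdp_mulr.
- exact: dvdp_mull.
have [lf|nlf] := boolP (l %| f); first by left.
by right; rewrite -(Gauss_dvdpr g (q := f)) // irreducible_poly_coprime.
Qed.

Lemma ltn_size_mull f g :
  (1 < size f)%N -> g != 0 -> (size g < size (f * g)%R)%N.
Proof.
move=> f_gt1 g_neq0; have f_neq0 : f != 0 by rewrite -size_poly_gt0 ltnW.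
rewrite size_mul //; case: (size f) f_gt1 => [|[|m]] // _.
by rewrite addSn /= addSn ltnS leq_addl.
Qed.

Lemma irreducible_multiplicity l f : irreducible_poly l -> f != 0 ->
  exists e (h : {poly F}), f = l ^+ e * h /\ ~~ (l %| h).
Proof.
move=> irr_l; have [n] := ubnP (size f); elim: n f => // n IHn f.
rewrite ltnS => lefn f_neq0.
have [/dvdpP[h fE]|nlf] := boolP (l %| f); last first.
  by exists 0%N, f; rewrite expr0 mul1r.
have h_neq0 : h != 0 by apply: contraNneq f_neq0 => h0; rewrite fE h0 mul0r.
have l_gt1 : (1 < size l)%N by case: irr_l.
have [|//|e [k [hE nlk]]] := IHn h.
  by apply: leq_trans lefn; rewrite fE mulrC ltn_size_mull.
by exists e.+1, k; split=> //; rewrite fE hE exprSr mulrAC.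
Qed.

(** Induction on the degree, stripping off the full power [l ^+ e] of an irreducible factor. If
    [e = 1], then [l] joins [s]; otherwise [e] is [2i] or [2i + 3] and is absorbed by [a] and [b].
    Constants end up in [s]. *)
Lemma squarefull_decomposition f g : f != 0 ->
    (forall l, irreducible_poly l -> l %| f -> ~~ (l ^+ 2 %| f) -> l %| g) ->
  exists s a b : {poly F}, f = s * a ^+ 2 * b ^+ 3 /\ s %| g.
Proof.
have [n] := ubnP (size f); elim: n f => // n IHn f.
rewrite ltnS => lefn f_neq0 simple_dvd.
have [f_gt1|f_le1] := ltnP 1 (size f); last first.
  exists f, 1, 1; rewrite !expr1n !mulr1; split=> //.
  have : size f == 1%N by rewrite eqn_leq f_le1 size_poly_gt0.
  by rewrite size_poly_eq1 => /eqp_dvdl->; rewrite dvd1p.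
have [l irr_l lf] := irreducible_factor f_gt1.
have [e [h [fE nlh]]] := irreducible_multiplicity irr_l f_neq0.
have l_gt1 : (1 < size l)%N by case: irr_l.
have l_neq0 := irredp_neq0 irr_l.
have e_gt0 : (0 < e)%N.
  by case: e fE => // fE; move: lf; rewrite fE mul1r (negPf nlh).
have h_neq0 : h != 0 by apply: contraNneq nlh => ->; rewrite dvdp0.
have [||k irr_k kh nk2h|s [a [b [hE sg]]]] := IHn h.
- apply: leq_trans lefn; rewrite fE ltn_size_mull //.
  have := size_exp l e; case: (size l) l_gt1 => [|[|m]] //= _.
  by move: (size (l ^+ e)) => k; nia.
- by [].
(* The hypothesis passes to [h]: an irreducible [k] dividing [h] is not associate to [l], hence is
   coprime to [l ^+ e], so [k ^+ 2] divides [f] only if it divides [h]. *)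
- apply: simple_dvd => //; first by rewrite fE dvdp_mull.
  rewrite fE Gauss_dvdpr // coprimep_expl // coprimep_expr //.
  rewrite irreducible_poly_coprime //; apply/negP => kl.
  case/negP: nlh; apply: dvdp_trans kh.
  have := irr_l.2 k; rewrite kl neq_ltn irr_k.1 orbT.
  by move=> /(_ isT isT)/eqp_dvdr->.
have cop_ls : coprimep l s.
  rewrite irreducible_poly_coprime //; apply: contra nlh => ls.
  by rewrite hE -mulrA dvdp_mulr.
have [e1|e_neq1] := eqVneq e 1%N.
  exists (l * s), a, b; rewrite fE hE e1 expr1 !mulrA; split=> //.
  rewrite Gauss_dvdp // sg andbT; apply: simple_dvd => //.
  rewrite fE e1 expr1 expr2 dvdp_mul2l //.
have [[i eE]|[i eE]] : (exists i, e = i * 2)%N \/ (exists i, e = i * 2 + 3)%N.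
  have [oe|oe] := boolP (odd e); first by right; exists (e./2 - 1)%N; lia.
  by left; exists e./2; lia.
- exists s, (l ^+ i * a), b; split=> //.
  by rewrite fE hE eE exprM; ring.
- exists s, (l ^+ i * a), (l * b); split=> //.
  by rewrite fE hE eE exprD exprM; ring.
Qed.
End PolyFactorization.

(** * Adic valuations at principal ideals *)

Lemma ideal_pow_principal (A : comNzRingType) (f : A) n :
  ideal_pow (principal_ideal f) n = principal_ideal (f ^+ n).
Proof.
elim: n => [|n IHn]; apply/seteqP; split=> x //.
- by move=> _; exists x; rewrite mulr1.
- rewrite /ideal_pow iterS -/(ideal_pow _ n) IHn => -[s [sP ->]].
  elim: s sP => [|ab s IHs] sP; first by exists 0; rewrite big_nil mul0r.
  have [|c sE] := IHs _ => [cd cds|]; first by apply: sP; rewrite inE cds orbT.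
  have [[a ab1] [b ab2]] := sP ab (mem_head _ _).
  by exists (a * b + c); rewrite big_cons sE ab1 ab2 exprS; ring.
- case=> h ->; rewrite /ideal_pow iterS -/(ideal_pow _ n) IHn.
  exists [:: (f, h * f ^+ n)]; split; last by rewrite big_seq1 exprS mulrCA.
  by move=> ab; rewrite inE => /eqP->; split; [exists 1; rewrite mul1r|exists h].
Qed.

Lemma principal_ideal_exp_le (A : comNzRingType) (f x : A) m n : (m <= n)%N ->
  principal_ideal (f ^+ n) x -> principal_ideal (f ^+ m) x.
Proof.
by move=> le_mn [h ->]; exists (h * f ^+ (n - m)); rewrite -mulrA -exprD subnK.
Qed.

(** The powers of the ideal are nested, so the exponent selected by [xget] is unique; valuations
    thereby become divisibility by powers of [f]. *)
Lemma adic_val_principal (A : comNzRingType) (f x : A) n :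
  adic_val (principal_ideal f) x = Some n <->
  principal_ideal (f ^+ n) x /\ ~ principal_ideal (f ^+ n.+1) x.
Proof.
rewrite /adic_val; split.
  case: xgetP => // v _ [m ->]; rewrite !ideal_pow_principal.
  by move=> fm [<-].
move=> [fn nfn]; apply: xget_unique => [|v [m ->]].
  by exists n; rewrite ?ideal_pow_principal.
rewrite !ideal_pow_principal => -[fm nfm]; congr Some.
case: (ltngtP m n) => // lt_mn.
  by case: nfm; apply: principal_ideal_exp_le fn.
by case: nfn; apply: principal_ideal_exp_le fm.
Qed.

Section PolyValuation.
Variable F : fieldType.
Implicit Types f g l : {poly F}.

Lemma principal_ideal_poly f g : principal_ideal f g <-> f %| g.
Proof. by split=> [/dvdpP|/dvdpP]. Qed.

Lemma adic_val_poly0 l g :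
  adic_val (principal_ideal l) g = Some 0%N <-> ~~ (l %| g).
Proof.
rewrite adic_val_principal expr0 expr1 !principal_ideal_poly dvd1p.
by split=> [[_ /negP]|/negP].
Qed.

Lemma adic_val_X0 g : adic_val (principal_ideal 'X) g = Some 0%N <-> g`_0 != 0.
Proof.
rewrite adic_val_poly0 -[X in X %| _]subr0 -polyC0 dvdp_XsubCl.
by rewrite /root horner_coef0.
Qed.

Lemma irreducible_prime_ideal l :
  irreducible_poly l -> nonzero_prime_ideal (principal_ideal l).
Proof.
move=> irr_l.
have memE (f : {poly F}) : (f \in mem (principal_ideal l)) = (l %| f).
  apply/idP/idP => [/set_mem/principal_ideal_poly //|lf].
  exact/mem_set/principal_ideal_poly.
split.
- split=> [||a u v]; rewrite ?memE ?dvdp0 //.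
    by rewrite dvdp1 neq_ltn irr_l.1 orbT.
  by move=> lu lv; rewrite dvdp_add // dvdp_mull.
- by move=> u v; rewrite !memE irreducible_dvdpM.
- move=> l0; have : principal_ideal l l by exact/principal_ideal_poly.
  by rewrite l0 /= => /eqP; apply/negP/irredp_neq0.
Qed.

End PolyValuation.

(** * Counting triples of bounded degree *)

Section Counting.
Variable F : finFieldType.
Local Notation q := #|F|.
Local Notation vec3 N := ('rV[F]_N * 'rV[F]_N * 'rV[F]_N)%type.
Implicit Types (f g l : {poly F}) (S : set ({poly F} * {poly F} * {poly F})).

(** Coefficient vectors form a finite type, so the sets of triples of degree below [N] can be
    counted by product rules. *)
Definition poly3 N (v : vec3 N) : {poly F} * {poly F} * {poly F} :=
  (rVpoly v.1.1, rVpoly v.1.2, rVpoly v.2).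

Lemma poly3_inj N : injective (@poly3 N).
Proof.
by move=> [[a b] c] [[a' b'] c'] [] /(can_inj rVpolyK)-> /(can_inj rVpolyK)->
  /(can_inj rVpolyK)->.
Qed.

Lemma absA_lt f N : (absA f < q ^ N)%N = (size f <= N)%N.
Proof.
have q_gt1 : (1 < q)%N := card_finNzRing_gt1 F.
rewrite /absA; have [->|f_neq0] := eqVneq f 0.
  by rewrite size_poly0 expn_gt0 ltnW.
by rewrite ltn_exp2l // -ltnS prednK // size_poly_gt0.
Qed.

Lemma size_rVpoly N (v : 'rV[F]_N) : (size (rVpoly v) <= N)%N.
Proof. exact: size_poly. Qed.

Lemma rVpoly_eq0 N (v : 'rV[F]_N) : (rVpoly v == 0) = (v == 0).
Proof. exact: (raddf_eq0 _ (can_inj rVpolyK)). Qed.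

Lemma card_trunc3 S N :
  #|` fset_set (trunc3 S N)| =
  #|[pred v : vec3 N | `[< S (poly3 v) /\ W3 (poly3 v) >]]|.
Proof.
set P := [pred v | _].
have -> : trunc3 S N = [set` [fset poly3 v | v in P]%fset].
  apply/seteqP; split=> [[[a b] c] [/= Sg [Wg]]|
                         g /imfsetP[v /asboolP[Sv Wv] ->]].
    rewrite !gtn_max !absA_lt -andbA => /and3P[aN bN cN].
    have E : (a, b, c) =
        poly3 (poly_rV a : 'rV_N, poly_rV b : 'rV_N, poly_rV c : 'rV_N).
      by rewrite /poly3 /= !poly_rV_K.
    by rewrite E; apply/imfsetP; exists (poly_rV a, poly_rV b, poly_rV c) => //;
      apply/asboolP; rewrite -E.
  by split=> //; split=> //; rewrite /abs3 /= !gtn_max !absA_lt !size_rVpoly.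
by rewrite set_fsetK card_imfset ?cardE //; apply: poly3_inj.
Qed.

Lemma card_W3 N :
  #|` fset_set (trunc3 (@W3 F) N)| = (q ^ N * q ^ N * (q ^ N - 1))%N.
Proof.
have cardN : #|{: 'rV[F]_N}| = (q ^ N)%N by rewrite card_mx mul1n.
rewrite card_trunc3.
rewrite (@eq_card _ _ [predX [predX predT & predT] & predC1 (0 : 'rV[F]_N)]).
  by rewrite !cardX cardC1 cardN subn1.
move=> [[a b] c]; rewrite !inE /=; apply/asboolP/idP => /=.
  by case=> _; rewrite /W3 /= rVpoly_eq0.
by move=> c0; have : W3 (poly3 (a, b, c)) by rewrite /W3 /= rVpoly_eq0.
Qed.

Definition const_neq0 g : bool := g`_0 != 0.

(** A vector splits into its constant term, with q - 1 nonzero choices, and [n] free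
    coefficients. *)
Lemma card_const_neq0 n :
  #|[pred v : 'rV[F]_n.+1 | const_neq0 (rVpoly v)]| = ((q - 1) * q ^ n)%N.
Proof.
have cf (v : 'rV[F]_n.+1) : (rVpoly v)`_0 = v 0 0.
  by rewrite (coef_rVpoly_ord v ord0).
pose h (cw : F * 'rV[F]_n) : 'rV[F]_n.+1 :=
  row_mx (m := 1) (n1 := 1) (cw.1)%:M cw.2.
have h_inj : injective h.
  move=> [c w] [c' w']; move/(@eq_row_mx F 1 1 n _ _ _ _)=> [/= cc' ->].
  by move/(congr1 (fun M : 'M[F]_1 => M 0 0)): cc'; rewrite !mxE !mulr1n => ->.
rewrite -[(q ^ n)%N](_ : #|{: 'rV[F]_n}| = _); last by rewrite card_mx mul1n.
rewrite subn1 -(cardC1 (0 : F)) -cardX -(fintype.card_image h_inj).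
apply: eq_card => v.
rewrite !inE /const_neq0 cf; apply/idP/fintype.imageP => [v0|[[c w]]].
  exists (v 0 0, rsubmx (v : 'M[F]_(1, 1 + n))); first by rewrite !inE /= andbT.
  have vl : lsubmx (v : 'M[F]_(1, 1 + n)) = (v 0 0)%:M.
    apply/matrixP => i j; rewrite !mxE !ord1 mulr1n.
    by congr (v _ _); apply/val_inj.
  by rewrite /h /= -vl; apply/esym/(hsubmxK (v : 'M[F]_(1, 1 + n))).
rewrite !inE /= andbT => c0 ->.
have -> : h (c, w) 0 0 = row_mx (c%:M : 'M[F]_1) w 0 (lshift n 0).
  by congr (row_mx _ _ _ _); apply/val_inj.
by rewrite row_mxEl mxE eqxx.
Qed.

Lemma card_const_neq0_3 n :
  let C := [pred v : 'rV[F]_n.+1 | const_neq0 (rVpoly v)] in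
  #|[predX [predX C & C] & C]| = (((q - 1) * q ^ n) ^ 3)%N.
Proof. by rewrite /= !cardX card_const_neq0; ring. Qed.

(** * Scarcity of the exceptional pairs (g_2, g_3) *)

Definition simple_primes_divide f g : Prop :=
  forall l, irreducible_poly l -> l %| f -> ~~ (l ^+ 2 %| f) -> l %| g.

(** Four polynomials are stored end to end in one coefficient vector, so that only the total of
    their sizes enters the count; the last length need not be recorded. *)
Definition poly_blocks i j k f :=
  let f1 := drop_poly i f in let f2 := drop_poly j f1 in
  (take_poly i f, take_poly j f1, take_poly k f2, drop_poly k f2).

Lemma poly_blocks_surj K (a b c d : {poly F}) :
  (size a + size b + size c + size d <= K)%N ->
  exists w : 'rV[F]_K,
    poly_blocks (size a) (size b) (size c) (rVpoly w) = (a, b, c, d).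
Proof.
move=> leK.
pose r := c + d * 'X^(size c); pose s := b + r * 'X^(size b).
have size_block (p t : {poly F}) :
    (size (p + t * 'X^(size p))%R <= size p + size t)%N.
  rewrite (leq_trans (size_polyD _ _)) // geq_max leq_addr /=.
  by have [->|t0] := eqVneq t 0; rewrite ?mul0r ?size_poly0 // size_mulXn.
exists (poly_rV (a + s * 'X^(size a))); rewrite /poly_blocks poly_rV_K.
  by rewrite !(take_polyDMXn, drop_polyDMXn).
apply: leq_trans leK; rewrite -!addnA; apply: leq_trans (size_block _ _) _.
rewrite leq_add2l; apply: leq_trans (size_block _ _) _.
by rewrite leq_add2l; apply: leq_trans (size_block _ _) _.
Qed.

(* By [squarefull_decomposition] such a pair is (s m, s a^2 b^3); the sizes of
   s, m, a, b add up to at most N + N / 2 + 3. *)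
Lemma card_simple_primes_divide N :
  (#|[pred v : 'rV[F]_N * 'rV[F]_N |
      `[< [/\ rVpoly v.1 != 0%R, rVpoly v.2 != 0%R &
          simple_primes_divide (rVpoly v.2) (rVpoly v.1)] >]]|
   <= N.+1 ^ 3 * q ^ (N + N./2 + 3))%N.
Proof.
set P := [pred v | _]; set K := (N + N./2 + 3)%N.
(* Three block lengths, each at most [N], and one vector of length [K] account for the factors
   [N.+1 ^ 3] and [q ^ K]. *)
pose decode (x : 'I_N.+1 * 'I_N.+1 * 'I_N.+1 * 'rV[F]_K) :
    'rV[F]_N * 'rV[F]_N :=
  let: (s, m, a, b) := poly_blocks x.1.1.1 x.1.1.2 x.1.2 (rVpoly x.2) in
  (poly_rV (s * m), poly_rV (s * a ^+ 2 * b ^+ 3)).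
have sPd : P \subset codom decode.
  apply/fintype.subsetP => -[u v] /asboolP[/= u0 v0].
  case/(squarefull_decomposition v0) => s [a [b [vE /dvdpP[m uE]]]].
  have /andP[m0 s0] : (m != 0) && (s != 0) by rewrite -negb_or -mulf_eq0 -uE.
  have a0 : a != 0.
    by apply: contraNneq v0 => a0; rewrite vE a0 expr0n mulr0 mul0r.
  have b0 : b != 0 by apply: contraNneq v0 => b0; rewrite vE b0 expr0n mulr0.
  have := size_rVpoly u; have := size_rVpoly v.
  have a20 := expf_neq0 2 a0; have b30 := expf_neq0 3 b0.
  rewrite uE vE (size_mul m0 s0) (size_mul (mulf_neq0 s0 a20) b30).
  rewrite (size_mul s0 a20) => vN uN.
  have [leK leN] : (size s + size m + size a + size b <= K)%N /\
      [/\ size s <= N, size m <= N & size a <= N]%N.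
    (* In degrees, deg s + deg m <= N - 1 and deg s + 2 deg a + 3 deg b <= N - 1, so deg a + deg b
       <= N / 2. Passing from four degrees to four sizes adds 4, hence the 3 in [K]. *)
    have arith (x y z t z2 t3 : nat) : (0 < x)%N -> (0 < y)%N -> (0 < z)%N ->
        (0 < t)%N -> (0 < z2)%N -> (0 < t3)%N ->
        z2.-1 = (z.-1 * 2)%N -> t3.-1 = (t.-1 * 3)%N ->
        ((y + x).-1 <= N)%N -> (((x + z2).-1 + t3).-1 <= N)%N ->
        (x + y + z + t <= K)%N /\ [/\ x <= N, y <= N & z <= N]%N.
      by rewrite /K => *; split; [|split]; lia.
    by apply: arith (size_exp a 2) (size_exp b 3) uN vN; rewrite size_poly_gt0.
  have [w wE] := poly_blocks_surj leK; case: leN => sN mN aN; apply/codomP.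
  exists (inord (size s), inord (size m), inord (size a), w).
  rewrite /decode /= !inordK //; case: wE => -> -> -> ->.
  by rewrite [s * m]mulrC -uE -vE !rVpolyK.
apply: leq_trans (subset_leq_card sPd) _.
apply: leq_trans (leq_image_card _ _) _.
by rewrite !card_prod card_ord card_mx mul1n -!mulnA.
Qed.

(** * Upper and lower bounds for the truncations of [S3] *)

Lemma card_S3_le p n :
  (#|` fset_set (trunc3 (@S3 F p) n.+1)| <= ((q - 1) * q ^ n) ^ 3)%N.
Proof.
rewrite card_trunc3 -card_const_neq0_3.
apply: subset_leq_card; apply/fintype.subsetP => -[[a b] c].
move=> /asboolP[/= [_ [ha hb hc] _] _].
by rewrite !inE /= -andbA; apply/and3P; split; apply/adic_val_X0.
Qed.

(** A prime dividing [c] exactly once and not dividing [b] is the required witness: its valuation 1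
    is not a multiple of [p], and it differs from (T) because [c] has nonzero constant term. *)
Lemma S3_mem p a b c : p != 1%N ->
    const_neq0 a -> const_neq0 b -> const_neq0 c ->
  ~ simple_primes_divide c b -> S3 p (a, b, c).
Proof.
move=> p_neq1 a0 b0 c0 nsimple.
have c_neq0 : c != 0 by apply: contraNneq c0 => ->; rewrite coef0.
have [l [irr_l lc nl2c nlb]] :
    exists l, [/\ irreducible_poly l, l %| c, ~~ (l ^+ 2 %| c) & ~~ (l %| b)].
  apply: contrapT => no; apply: nsimple => l irr_l lc nl2c.
  by apply: contrapT => /negP nlb; apply: no; exists l.
split=> //; first by split; apply/adic_val_X0.
exists (principal_ideal l); split.
- exact: irreducible_prime_ideal.
- move=> lX; have : principal_ideal 'X c.
    by rewrite -lX; apply/principal_ideal_poly.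
  by apply/principal_ideal_poly/negP/adic_val_poly0/adic_val_X0.
- exact/adic_val_poly0.
- exists 1%N; last by rewrite dvdn1.
  by apply/adic_val_principal; rewrite expr1; split;
    [|move/principal_ideal_poly; apply/negP]; rewrite ?principal_ideal_poly.
Qed.

(** A triple with nonzero constant terms outside [S3] has its last two entries in an exceptional
    pair, while the first is left arbitrary; this gives the error term. *)
Lemma card_S3_ge p n : p != 1%N ->
  (((q - 1) * q ^ n) ^ 3 <= #|` fset_set (trunc3 (@S3 F p) n.+1)| +
     q ^ n.+1 * (n.+2 ^ 3 * q ^ (n.+1 + n.+1./2 + 3)))%N.
Proof.
move=> p_neq1; rewrite card_trunc3 -card_const_neq0_3 /=.
set C := [pred v | const_neq0 _]; set S := [pred v | _].
set B := [pred v : 'rV[F]_n.+1 * 'rV[F]_n.+1 |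
  `[< [/\ rVpoly v.1 != 0, rVpoly v.2 != 0 &
      simple_primes_divide (rVpoly v.2) (rVpoly v.1)] >]].
pose h (x : 'rV[F]_n.+1 * ('rV[F]_n.+1 * 'rV[F]_n.+1)) := (x.1, x.2.1, x.2.2).
set H := [seq h x | x in [predX predT & B]].
have CS : [predX [predX C & C] & C] \subset [predU S & H].
  apply/fintype.subsetP => -[[a b] c].
  rewrite !inE /= => /andP[/andP[a0 b0] c0].
  have neq0 (v : 'rV[F]_n.+1) : const_neq0 (rVpoly v) -> rVpoly v != 0.
    by apply: contraNneq => ->; rewrite coef0.
  have [sp|nsp] := pselect (simple_primes_divide (rVpoly c) (rVpoly b)).
    have Bbc : (b, c) \in B by apply/asboolP; split=> //; apply: neq0.
    by apply/orP; right; apply/fintype.imageP; exists (a, (b, c)).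
  apply/orP; left; apply/asboolP; split; last exact: neq0.
  exact: S3_mem.
apply: leq_trans (subset_leq_card CS) _.
apply: leq_trans (leq_addr #|[predI S & H]| _) _; rewrite cardUI leq_add2l.
apply: leq_trans (leq_image_card _ _) _.
by rewrite cardX card_mx mul1n leq_mul2l card_simple_primes_divide orbT.
Qed.

End Counting.

(** * Elementary estimates for the error term *)

Lemma leq_bin_exp2 n m : ('C(n, m) <= 2 ^ n)%N.
Proof.
elim: n m => [|n IHn] [|m]; rewrite ?bin0 ?expn_gt0 //.
by rewrite binS expnS mul2n -addnn leq_add.
Qed.

(** Each of the [m] factors of the falling factorial is at least [k.+1]. *)
Lemma leq_expS_ffact k m : (k.+1 ^ m <= (k + m) ^_ m)%N.
Proof.
elim: m => // m IHm; rewrite addnS ffactSS expnS.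
by rewrite leq_mul // ltnS leq_addr.
Qed.

Lemma leq_expS_exp2 k m : (k.+1 ^ m <= 2 ^ (k + m) * m`!)%N.
Proof.
apply: leq_trans (leq_expS_ffact k m) _.
by rewrite -bin_ffact leq_mul2r leq_bin_exp2 orbT.
Qed.

(** The extra factor [N.+1] on the left makes the error O(1 / (N + 1)) relative to q^(3N), the rate
    needed for the squeeze against [harmonic]. *)
Lemma error_term_bound q N : (1 < q)%N ->
  (q ^ N * (N.+1 ^ 3 * q ^ (N + N./2 + 3)) * N.+1 <=
   16 * 384 * q ^ 3 * (q ^ N) ^ 3)%N.
Proof.
move=> q_gt1.
(* Here [k] is N / 2 rounded up; q^(2N) exceeds [q ^ (N + N./2)] by the factor [q ^ k], which
   absorbs the fourth power of N + 1. *)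
have [k [le_N def_N]] : exists k, (N.+1 <= 2 * k.+1 /\ N = N./2 + k)%N.
  by exists (N - N./2)%N; lia.
(* The 16 is 2^4, from [N.+1 <= 2 * k.+1]; the 384 is 2^4 * 4!, from [leq_expS_exp2] with m = 4. *)
have leM : (N.+1 ^ 4 <= 16 * 384 * q ^ k)%N.
  have le2 : (N.+1 ^ 4 <= 16 * k.+1 ^ 4)%N by rewrite -(expnMn 2 _ 4) leq_exp2r.
  have lek : (k.+1 ^ 4 <= 384 * 2 ^ k)%N.
    by apply: leq_trans (leq_expS_exp2 k 4) _; rewrite expnD -mulnA mulnC.
  have : (2 ^ k <= q ^ k)%N by case: (k) => // j; rewrite leq_exp2r.
  move: le2 lek.
  by move: (N.+1 ^ 4)%N (2 ^ k)%N (q ^ k)%N (k.+1 ^ 4)%N => x y z w; lia.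
have E : ((q ^ N) ^ 2 = q ^ (N + N./2) * q ^ k)%N.
  by rewrite -expnM -expnD; congr (_ ^ _)%N; lia.
rewrite [((q ^ N) ^ 3)%N]expnS E expnD.
have := leq_mul (leqnn (q ^ N * q ^ (N + N./2) * q ^ 3)) leM.
move: (q ^ N)%N (q ^ (N + N./2))%N (q ^ 3)%N (q ^ k)%N => a b c d.
by congr (_ <= _)%N; ring.
Qed.

(** To be read with Q = q^N, M = N + 1, [s] the count for [S3] and [e] the error. The lower bound
    pays for [e], the upper bound for the denominator Q^2 (Q - 1) in place of Q^3; with c <= 1 <= D,
    Q >= 2 and M <= Q, each cost stays within 2 D / M. *)
Lemma ratio_bounds (R : realFieldType) (c D M Q s e : R) :
    0 <= c <= 1 -> 1 <= D -> 1 <= M -> 2 <= Q -> M <= Q ->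
    s <= c * Q ^+ 3 -> c * Q ^+ 3 <= s + e -> e * M <= D * Q ^+ 3 ->
  c - 2 * D * M^-1 <= s / (Q * Q * (Q - 1)) <= c + 2 * D * M^-1.
Proof.
move=> /andP[c0 c1] D1 M1 Q2 MQ sU sL eM.
have M0 : 0 < M by lra.
have W0 : 0 < Q * Q * (Q - 1) by rewrite !mulr_gt0 //; lra.
set t := M^-1; have t0 : 0 < t by rewrite invr_gt0.
have Qt : 1 <= Q * t by rewrite ler_pdivlMr // mul1r.
have et : e <= D * Q ^+ 3 * t by rewrite ler_pdivlMr.
have Dt : 1 <= D * (t * Q) by nra.
have DtQ : 0 <= D * t * Q ^+ 2 * (Q - 2).
  by rewrite !mulr_ge0 ?exprn_ge0 //; lra.
rewrite ler_pdivlMr // ler_pdivrMr //; apply/andP; split.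
  have cQ : 0 <= c * Q ^+ 2 by rewrite mulr_ge0 ?exprn_ge0 //; lra.
  lra.
have : 0 <= Q ^+ 2 * (D * (t * Q) - c) by rewrite mulr_ge0 ?exprn_ge0 //; lra.
lra.
Qed.

(** * Passage to the limit by squeezing *)

Theorem theorem3p10 (R : realType) (F : finFieldType) (p q : nat)
    (hF : #|F| = q) (hp : p \in [pchar F]) (q_odd : odd q) (q_gt9 : (9 < q)%N) :
  has_density (S3 (F := F) p) ((1 - 1 / q%:R) ^+ 3 : R).
Proof.
have q_gt1 : (1 < q)%N by rewrite -hF card_finNzRing_gt1.
have p_neq1 : p != 1%N by rewrite neq_ltn orbC prime_gt1 // (pcharf_prime hp).
set c := (1 - _) ^+ 3; pose D : R := (16 * 384 * q ^ 3)%:R.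
have lim (x : R) : (c + x * harmonic N) @[N --> \oo] --> c.
  rewrite -[X in _ --> X]addr0 -(mulr0 x).
  by apply: cvgD; [apply: cvg_cst | apply: cvgMr; apply: cvg_harmonic].
apply: (squeeze_cvgr _ (lim (- (2 * D))) (lim (2 * D))).
(* N = 0 is set aside: no triple in [W3] has |g| < 1, so the ratio there is 0 / 0. *)
exists 1%N => // -[//|n] _.
rewrite /= mulNr /harmonic /density_ratio card_W3 hF.
have qR : (q%:R : R) != 0 by rewrite pnatr_eq0 -lt0n ltnW.
(* The main term is exact: it is the number of triples with nonzero constant terms. *)
have cQ : c * (q ^ n.+1)%:R ^+ 3 = (((q - 1) * q ^ n) ^ 3)%:R.
  rewrite [RHS]natrX /c -exprMn expnS !natrM natrB ?(ltnW q_gt1) //.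
  by congr (_ ^+ 3); field.
have le_Q : (n.+2 <= q ^ n.+1)%N by apply: ltn_expl.
rewrite !natrM natrB ?expn_gt0 ?(ltnW q_gt1) //.
apply: (@ratio_bounds _ _ _ _ _ _
  (q ^ n.+1 * (n.+2 ^ 3 * q ^ (n.+1 + n.+1./2 + 3)))%:R).
- have r0 : 0 <= 1 - 1 / q%:R :> R.
    by rewrite subr_ge0 div1r invf_le1 ?ler1n ?ltr0n (ltnW q_gt1).
  by rewrite exprn_ge0 // exprn_ile1 // gerBl div1r invr_ge0.
- by rewrite /D ler1n !muln_gt0 (ltnW q_gt1).
- by rewrite ler1n.
- by rewrite ler_nat (leq_trans _ le_Q).
- by rewrite ler_nat.
- by rewrite cQ ler_nat -hF; apply: card_S3_le.
- by rewrite cQ -natrD ler_nat -hF; apply: card_S3_ge.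
- by rewrite -!natrX -!natrM ler_nat error_term_bound.
Qed.
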